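(* In the definition of the class $\mathcal{P}$, condition (A.5) can be replaced by an equivalent weaker condition. That is, for a velocity field $u$ with $u_3\equiv 0$ satisfying (A.1)-(A.4), the condition (A.5), namely $$\sup_{x_2\in\mathbb{R}}P(x_1,x_2,x_3,t)<\infty\quad\text{for all }x_1,x_3,t,$$ is equivalent to $$\limsup_{x_2\to\pm\infty}P(x_1,x_2,x_3,t)<\infty\quad\text{for any given }x_1,x_3\text{ and }t\in\mathbb{R}.$$
   Context: $\nu,h,\Pi_1,\Pi_2>0$ are constants and $\mathcal{O}=\mathbb{R}\times\mathbb{R}\times[0,h]$. Velocity fields $u=(u_1,u_2,u_3)(x,t)$, $x=(x_1,x_2,x_3)\in\mathcal{O}$, are solutions of the Navier-Stokes equations $\partial_t u+(u\cdot\nabla)u=\nu\Delta u-\nabla P$, $\nabla\cdot u=0$, with no-slip condition $u=0$ at $x_3=0$ and $x_3=h$; here $P=P(x,t)$ is the sum of pressure and a time-independent potential. Such a $u$ belongs to the class $\mathcal{P}$ if: (A.1) $u\in C^\infty(\mathcal{O}\times\mathbb{R})$; (A.2) $u$ is periodic in $x_1$ and $x_2$ with periods $\Pi_1$ and $\Pi_2$; it then follows that $P(x_1+\Pi_1,x_2,x_3,t)-P(x_1,x_2,x_3,t)=:p_1(t)$ and $P(x_1,x_2+\Pi_2,x_3,t)-P(x_1,x_2,x_3,t)=:p_2(t)$ depend only on $t$; (A.3) $u$ exists for all $t\in\mathbb{R}$ and has bounded energy per mass: $\int_0^{\Pi_1}\int_0^{\Pi_2}\int_0^h u\cdot u\,dx<\infty$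 for all $t\in\mathbb{R}$; (A.4) there is a constant $\bar p<\infty$ with $0<-p_1(t)\le\bar p$ and $|p_2(t)|\le\bar p$ for all $t\in\mathbb{R}$; (A.5) $\sup_{x_2\in\mathbb{R}}P(x_1,x_2,x_3,t)<\infty$ for all $x_1,x_3,t$. *)

(* Defs.v *)
From HB Require Import structures.
From mathcomp Require Import all_boot all_order all_algebra.
From mathcomp Require Import all_classical all_reals all_analysis.

Set Implicit Arguments.
Unset Strict Implicit.
Unset Printing Implicit Defensive.

Import Order.TTheory GRing.Theory Num.Theory.
Import numFieldNormedType.Exports.

Local Open Scope classical_set_scope.
Local Open Scope ring_scope.

(** * Calculus on a set with boundary

    The library's [derivable] and ['D_v] are two-sided.  Here the difference
    quotient is restricted to increments that stay in [D], so that at a boundary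
    point of the closed layer the derivative across the boundary is one-sided. *)

Section DerivativeWithin.
Context {R : realType} {V : normedModType R}.
Implicit Types (D : set V) (f : V -> R) (v a : V).

Definition quotient_within D f v a : set_system R :=
  (fun k : R => k^-1 * (f (a + k *: v) - f a))
    @ within [set k : R | D (a + k *: v)] 0^'.

Definition derivable_within D f v a : Prop := cvg (quotient_within D f v a).

Definition derive_within D f v a : R := lim (quotient_within D f v a).

(** Iterated directional derivatives up to order [n] exist on [D] and are
    continuous there, up to the boundary.  On a convex set with nonempty interior
    this is the usual C^n condition on iterated partial derivatives, since
    continuous partial derivatives give all directional ones.  Values outside [D]
    are irrelevant. *)
Fixpoint Cn_on D (n : nat) f : Prop :=
  {within D, continuous f} /\
  if n is m.+1 then
    forall v, (forall a, D a -> derivable_within D f v a) /\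
              Cn_on D m (derive_within D f v)
  else True.

Definition smooth_on D f : Prop := forall n, Cn_on D n f.

End DerivativeWithin.

(** * Navier-Stokes flows in a layer *)

Definition i1 : 'I_3 := @Ordinal 3 0 isT.
Definition i2 : 'I_3 := @Ordinal 3 1 isT.
Definition i3 : 'I_3 := @Ordinal 3 2 isT.

Section Flow.
Context {R : realType}.

Definition space_point (x1 x2 x3 : R) : 'rV[R]_3 :=
  \row_(i < 3) [:: x1; x2; x3]`_i.

Definition unit_vector (i : 'I_3) : 'rV[R]_3 := delta_mx 0 i.

Definition layer (h : R) : set 'rV[R]_3 := [set x | 0 <= x 0 i3 <= h].

Definition layer_time (h : R) : set ('rV[R]_3 * R) :=
  [set z | layer h z.1].

Definition partial_x (h : R) (i : 'I_3) (f : 'rV[R]_3 * R -> R)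
    (z : 'rV[R]_3 * R) : R :=
  derive_within (layer_time h) f (unit_vector i, 0) z.

Definition partial_t (h : R) (f : 'rV[R]_3 * R -> R) (z : 'rV[R]_3 * R) : R :=
  derive_within (layer_time h) f (0, 1) z.

Definition component (u : 'rV[R]_3 * R -> 'rV[R]_3) (i : 'I_3)
    (z : 'rV[R]_3 * R) : R := u z 0 i.

(** Differentiability of [u] is not repeated here, it is part of
    [smooth_velocity]; for [P] only the existence of its spatial gradient is
    required. *)
Definition navier_stokes (nu h : R) (u : 'rV[R]_3 * R -> 'rV[R]_3)
    (P : 'rV[R]_3 * R -> R) : Prop :=
  forall z, layer_time h z ->
  [/\ forall i, derivable_within (layer_time h) P (unit_vector i, 0) z,
      forall i,
        partial_t h (component u i) z
        + \sum_(j < 3) component u j z * partial_x h j (component u i) z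
        = nu * (\sum_(j < 3) partial_x h j (partial_x h j (component u i)) z)
          - partial_x h i P z
    & \sum_(j < 3) partial_x h j (component u j) z = 0].

Definition no_slip (h : R) (u : 'rV[R]_3 * R -> 'rV[R]_3) : Prop :=
  forall (x : 'rV[R]_3) (t : R), x 0 i3 = 0 \/ x 0 i3 = h -> u (x, t) = 0.

Definition smooth_velocity (h : R) (u : 'rV[R]_3 * R -> 'rV[R]_3) : Prop :=
  forall i, smooth_on (layer_time h) (component u i).

Definition periodic_velocity (h Pi1 Pi2 : R)
    (u : 'rV[R]_3 * R -> 'rV[R]_3) : Prop :=
  forall (x : 'rV[R]_3) (t : R), layer h x ->
    u (x + Pi1 *: unit_vector i1, t) = u (x, t) /\
    u (x + Pi2 *: unit_vector i2, t) = u (x, t).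

Definition finite_energy (h Pi1 Pi2 : R)
    (u : 'rV[R]_3 * R -> 'rV[R]_3) : Prop :=
  forall t,
  (\int[lebesgue_measure]_(x1 in `[0%R, Pi1])
   \int[lebesgue_measure]_(x2 in `[0%R, Pi2])
   \int[lebesgue_measure]_(x3 in `[0%R, h])
     (\sum_(i < 3) component u i (space_point x1 x2 x3, t) ^+ 2)%:E < +oo)%E.

(** For solutions with periodic velocity the increments of [P] over one period
    are independent of [x]; this is a consequence of the equations and is not
    assumed, so the bounds below are imposed at every [x]. *)
Definition pressure_increment (P : 'rV[R]_3 * R -> R) (p : R) (i : 'I_3)
    (x : 'rV[R]_3) (t : R) : R :=
  P (x + p *: unit_vector i, t) - P (x, t).

Definition bounded_pressure_drop (h Pi1 Pi2 : R)
    (P : 'rV[R]_3 * R -> R) : Prop :=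
  exists pbar : R, forall (x : 'rV[R]_3) (t : R), layer h x ->
    0 < - pressure_increment P Pi1 i1 x t <= pbar /\
    `|pressure_increment P Pi2 i2 x t| <= pbar.

Definition spanwise_sup_finite (h : R) (P : 'rV[R]_3 * R -> R) : Prop :=
  forall x1 x3 t : R, 0 <= x3 <= h ->
    (ereal_sup [set (P (space_point x1 x2 x3, t))%:E | x2 in [set: R]] < +oo)%E.

Definition spanwise_limsup_finite (h : R) (P : 'rV[R]_3 * R -> R) : Prop :=
  forall x1 x3 t : R, 0 <= x3 <= h ->
    (limf_esup (fun x2 : R => (P (space_point x1 x2 x3, t))%:E) +oo%R < +oo)%E /\
    (limf_esup (fun x2 : R => (P (space_point x1 x2 x3, t))%:E) -oo%R < +oo)%E.

End Flow.

(* Main.v *)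
Require Import Defs.
From HB Require Import structures.
From mathcomp Require Import all_boot all_order all_algebra.
From mathcomp Require Import all_classical all_reals all_analysis.

Import Order.TTheory GRing.Theory Num.Theory.
Import numFieldNormedType.Exports.

Local Open Scope ring_scope.

(** Since the spatial gradient of [P] exists on the layer, [P] is continuous
    along every spanwise line.  Such a line stays in the layer, so a bound near
    both ends together with the extreme value theorem on the remaining compact
    segment bounds [P] on the whole line; the converse is immediate. *)

(** [limf_esup f F] is the infimum, over the members [V] of [F], of the supremum of [f] on [V]; it
    is below [+oo] exactly when one of these suprema is. *)
Lemma limf_esup_lty (T : choiceType) (X : filteredType T) (R : realType)
    (f : X -> \bar R) (F : set (set X)) :
  (limf_esup f F < +oo)%E <->
  exists2 V, F V & exists M : R, forall x, V x -> (f x <= M%:E)%E.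
Proof.
rewrite limf_esupE; split.
  move=> /ereal_inf_lt[_ [V FV <-]] supV; exists V => //.
  (* If the supremum is [-oo], [fine] returns 0, which is still a bound because [f] is then [-oo] on
     [V]. *)
  exists (fine (ereal_sup [set f x | x in V]%classic)) => x Vx.
  have fx_le : (f x <= ereal_sup [set f x | x in V]%classic)%E.
    by apply: ereal_sup_ubound; exists x.
  case: (ereal_sup _) supV fx_le => [r||] //= _.
  by rewrite leeNy_eq => /eqP ->; rewrite leNye.
move=> [V FV [M fM]]; apply/ereal_inf_ltP.
exists (ereal_sup [set f x | x in V]%classic); first by exists V.
apply: le_lt_trans (ltry M); apply: ge_ereal_sup => _ [x Vx <-]; exact: fM.
Qed.

Lemma ereal_sup_range_lty (R : realType) (g : R -> R) :
  (ereal_sup [set (g x)%:E | x in [set: R]] < +oo)%E <->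
  exists M : R, forall x, g x <= M.
Proof.
split=> [sup_lty|[M gM]]; last first.
  apply: le_lt_trans (ltry M); apply: ge_ereal_sup => _ [x _ <-].
  by rewrite lee_fin.
have gx_le x : ((g x)%:E <= ereal_sup [set (g x)%:E | x in [set: R]])%E.
  by apply: ereal_sup_ubound; exists x.
case: (ereal_sup _) sup_lty gx_le => [r||] // _ gx_le.
  by exists r => x; rewrite -lee_fin.
(* The supremum cannot be [-oo], since it dominates the real number [g 0]. *)
by have := gx_le 0; rewrite leeNy_eq.
Qed.

Lemma continuous_ereal_sup_lty {R : realType} {g : R -> R} :
  continuous g ->
  (ereal_sup [set (g x)%:E | x in [set: R]] < +oo)%E <->
  (limf_esup (fun x => (g x)%:E) +oo%R < +oo)%E /\
  (limf_esup (fun x => (g x)%:E) -oo%R < +oo)%E.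
Proof.
move=> g_cont; split.
  move=> /ereal_sup_range_lty[M gM]; split; apply/limf_esup_lty;
    exists [set: R]%classic; try (by exists 0; split);
    by exists M => x _; rewrite lee_fin.
move=> [/limf_esup_lty[V [a [_ aV]] [A gA]] /limf_esup_lty[W [b [_ bW]] [B gB]]].
apply/ereal_sup_range_lty.
(* The bounds [A] and [B] hold for [a < x] and [x < b]. The thresholds may come in either order, so
   [min] and [max] make the segment nonempty; it contains every [x] with [b <= x <= a], the points
   left uncovered. *)
have ba : Num.min b a <= Num.max b a by rewrite ge_min le_max lexx.
have [c _ gc] := EVT_max ba (continuous_subspaceT g_cont).
exists (Num.max A (Num.max B (g c))) => x; rewrite !le_max.
have [/aV/gA|xa] := ltP a x; first by rewrite lee_fin => ->.
have [/bW/gB|bx] := ltP x b; first by rewrite lee_fin => ->; rewrite orbT.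
by rewrite gc ?orbT// in_itv/= ge_min bx le_max xa orbT.
Qed.

(** When the whole line lies in [D], every increment is admissible, so the restricted filter is the
    full punctured neighbourhood filter and the two difference quotients coincide. *)
Lemma derivable_within_line {R : realType} {V : normedModType R} {D : set V}
    {f : V -> R} {a v : V} {x : R} :
  (forall k : R, D (a + k *: v)) -> derivable_within D f v (a + x *: v) ->
  derivable (fun y : R => f (a + y *: v)) x 1.
Proof.
move=> Dav; rewrite /derivable_within /quotient_within /derivable.
have -> : [set k : R | D (a + x *: v + k *: v)]%classic = [set: R]%classic.
  by apply/seteqP; split => // k _ /=; rewrite -addrA -scalerDl.
rewrite withinET; suff -> : (fun k : R =>
      k^-1 * (f (a + x *: v + k *: v) - f (a + x *: v))) =
    (fun k : R => k^-1 *: (((fun y : R => f (a + y *: v)) \o shift x) (k *: 1)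
                           - f (a + x *: v))) by [].
apply/funext => k /=.
by rewrite [k *: 1]mulr1 (addrC k) scalerDl addrA.
Qed.

Lemma space_point_line (R : realType) (x1 x2 x3 : R) :
  space_point x1 x2 x3 = space_point x1 0 x3 + x2 *: unit_vector i2.
Proof.
apply/rowP => -[[|[|[|]]] ilt] //=; rewrite !mxE/=;
  by rewrite ?mulr0 ?mulr1 ?addr0 ?add0r.
Qed.

Theorem corollary5p2 (R : realType) (nu h Pi1 Pi2 : R)
  (nu_gt0 : 0 < nu) (h_gt0 : 0 < h) (Pi1_gt0 : 0 < Pi1) (Pi2_gt0 : 0 < Pi2)
  (u : 'rV[R]_3 * R -> 'rV[R]_3) (P : 'rV[R]_3 * R -> R)
  (uP_NS : navier_stokes nu h u P)
  (u_no_slip : no_slip h u)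
  (u3_eq0 : forall z, layer_time h z -> component u i3 z = 0)
  (A1 : smooth_velocity h u)
  (A2 : periodic_velocity h Pi1 Pi2 u)
  (A3 : finite_energy h Pi1 Pi2 u)
  (A4 : bounded_pressure_drop h Pi1 Pi2 P) :
  spanwise_sup_finite h P <-> spanwise_limsup_finite h P.
Proof.
have P_cont x1 x3 t : 0 <= x3 <= h ->
    continuous (fun x2 : R => P (space_point x1 x2 x3, t)).
  move=> x3h x2; apply: differentiable_continuous; apply/derivable1_diffP.
  set a : 'rV[R]_3 * R := (space_point x1 0 x3, t).
  set v : 'rV[R]_3 * R := (unit_vector i2, 0).
  have lineE y : (space_point x1 y x3, t) = a + y *: v.
    by rewrite space_point_line; congr pair; rewrite /= scaler0 addr0.
  under eq_fun do rewrite lineE.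
  (* Moving along [v] leaves the third coordinate at [x3], hence inside the layer, even when [x3] is
     0 or [h]. *)
  have Dav y : layer_time h (a + y *: v).
    by rewrite -lineE /layer_time /layer /= mxE.
  by apply: (derivable_within_line Dav); have [/(_ i2)] := uP_NS _ (Dav x2).
(* Both conditions are imposed line by line, so the equivalence is applied with [x1], [x3] and [t]
   fixed. *)
split=> fin x1 x3 t x3h;
  apply/(continuous_ereal_sup_lty (P_cont x1 x3 t x3h));
  exact: fin.
Qed.
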